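(* Let $d,N_0\in\mathbb{N}$, $B>0$, $a\ge0$, and let $\varrho_a:\mathbb{R}\to\mathbb{R}$, $x\mapsto\max\{x,ax\}$ be the parametric ReLU. Then $\mathcal{RNN}_{\varrho_a}^{[-B,B]^d}((d,N_0,1))$ is closed in $C([-B,B]^d)$ (with the supremum norm).
   Context: $\mathcal{RNN}_{\varrho_a}^{[-B,B]^d}((d,N_0,1))$ is the set of all functions $[-B,B]^d\to\mathbb{R}$ of the form $x\mapsto A_2\varrho_a(A_1x+b_1)+b_2$ with $A_1\in\mathbb{R}^{N_0\times d}$, $b_1\in\mathbb{R}^{N_0}$, $A_2\in\mathbb{R}^{1\times N_0}$, $b_2\in\mathbb{R}$, where $\varrho_a$ acts componentwise. *)

(* Defs.v *)
From HB Require Import structures.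
From mathcomp Require Import all_boot all_order all_algebra.
From mathcomp Require Import all_classical all_reals all_analysis.
Import numFieldNormedType.Exports.
Unset Printing Implicit Defensive.
Import Order.TTheory GRing.Theory Num.Theory.
Local Open Scope classical_set_scope.
Local Open Scope ring_scope.

Definition prelu {R : realType} (a : R) (x : R) : R := Num.max x (a * x).

Definition cube {R : realType} (d : nat) (B : R) : set 'cV[R]_d :=
  [set x | forall i : 'I_d, - B <= x i ord0 <= B].

Definition shallow_net {R : realType} (d N0 : nat) (a : R)
  (A1 : 'M[R]_(N0, d)) (b1 : 'cV[R]_N0) (A2 : 'M[R]_(1, N0)) (b2 : R)
  (x : 'cV[R]_d) : R :=
  (A2 *m map_mx (prelu a) (A1 *m x + b1)) ord0 ord0 + b2.

(* RNN_{rho_a}^{[-B,B]^d}((d,N0,1)): functions on the cube (represented as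
   functions on R^d, only their values on the cube matter) realized by a
   shallow network.  Seen as a subset of the space of functions with the
   topology of uniform convergence on the cube (= sup norm on the cube). *)
Definition RNN {R : realType} (d N0 : nat) (a B : R)
  : set {uniform` cube d B -> R} :=
  [set f | exists (A1 : 'M[R]_(N0, d)) (b1 : 'cV[R]_N0)
             (A2 : 'M[R]_(1, N0)) (b2 : R),
           forall x, cube d B x -> f x = shallow_net d N0 a A1 b1 A2 b2 x].

(* Main.v *)
(* Take a limit of networks, scale the hidden affine functions h_i to norm 1 and pass
   to limits along an ultrafilter; write prelu as a linear part plus a multiple of
   the absolute value. Near a point off the zero sets of the limits of the h_i, the
   networks are eventually affine, so these affine pieces converge. Comparing the
   two sides of a limit hyperplane H, the sum of all terms whose limit vanishes on
   H converges, even if single coefficients diverge, and by continuity of the limit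
   f its limit vanishes on H. Hence f is an affine function plus one multiple of
   |h| for each limit hyperplane crossing the open cube. If there are as many such
   hyperplanes as neurons, all coefficients converge and f is the limit network.
   Otherwise one neuron is free to represent the affine part. *)
Require Import Defs.
From HB Require Import structures.
From mathcomp Require Import all_boot all_order all_algebra.
From mathcomp Require Import all_classical all_reals all_analysis.
From mathcomp Require Import ring lra.
Import numFieldNormedType.Exports.
Import Order.TTheory GRing.Theory Num.Theory.
Local Open Scope classical_set_scope.
Local Open Scope ring_scope.

(** * Affine functions on R^d as row vectors acting on homogeneous coordinates *)

Definition pairing {R : realType} {d : nat} (z : 'rV[R]_(1 + d))
  (X : 'cV[R]_(1 + d)) : R := (z *m X) ord0 ord0.
Definition dir {R : realType} {d : nat} (v : 'cV[R]_d) : 'cV[R]_(1 + d) :=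
  col_mx 0 v.
Definition point {R : realType} {d : nat} (x : 'cV[R]_d) : 'cV[R]_(1 + d) :=
  col_mx 1%:M x.

(* [z = row_mx b w] stands for the affine function [x |-> w x + b]: [aff z x]
   is its value at [x] and [lin z v] its derivative in the direction [v]. *)
Notation aff z x := (pairing z (point x)).
Notation lin z v := (pairing z (dir v)).

Definition open_cube {R : realType} {d : nat} (B : R) : set 'cV[R]_d :=
  [set x | forall i, `|x i ord0| < B].

Section AffineFunctions.
Set Implicit Arguments.
Unset Strict Implicit.
Variables (R : realType) (d : nat).
Implicit Types (z : 'rV[R]_(1 + d)) (x v : 'cV[R]_d) (X : 'cV[R]_(1 + d)).

Lemma pairingE z X : pairing z X = \sum_i z ord0 i * X i ord0.
Proof. by rewrite /pairing mxE. Qed.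

Lemma pairingDl z1 z2 X : pairing (z1 + z2) X = pairing z1 X + pairing z2 X.
Proof. by rewrite /pairing mulmxDl mxE. Qed.

Lemma pairingZl c z X : pairing (c *: z) X = c * pairing z X.
Proof. by rewrite /pairing -scalemxAl mxE. Qed.

Lemma pairingBl z1 z2 X : pairing (z1 - z2) X = pairing z1 X - pairing z2 X.
Proof. by rewrite /pairing mulmxBl !mxE. Qed.

Lemma pairing0l X : pairing 0 X = 0.
Proof. by rewrite /pairing mul0mx mxE. Qed.

Lemma pairing_suml (I : finType) (P : pred I) (z : I -> 'rV[R]_(1 + d)) X :
  pairing (\sum_(i | P i) z i) X = \sum_(i | P i) pairing (z i) X.
Proof. by rewrite /pairing mulmx_suml summxE. Qed.

Lemma pairingDr z X Y : pairing z (X + Y) = pairing z X + pairing z Y.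
Proof. by rewrite /pairing mulmxDr mxE. Qed.

Lemma pairingZr c z X : pairing z (c *: X) = c * pairing z X.
Proof. by rewrite /pairing -scalemxAr mxE. Qed.

Lemma pairing_delta z i : pairing z (delta_mx i ord0) = z ord0 i.
Proof.
rewrite pairingE (bigD1 i) //= mxE !eqxx mulr1 big1 ?addr0// => j /negPf ji.
by rewrite mxE ji mulr0.
Qed.

Lemma point_line x v t : point (x + t *: v) = point x + t *: dir v.
Proof. by rewrite /point /dir scale_col_mx add_col_mx scaler0 addr0. Qed.

Lemma point_dirP x X : exists c v, X = c *: point x + dir v.
Proof.
pose c := X (lshift d ord0) ord0.
exists c, (dsubmx X - c *: x).
rewrite /point /dir scale_col_mx add_col_mx addr0 addrC subrK -[LHS]vsubmxK.
congr col_mx; apply/colP => i.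
by rewrite ord1 !mxE eqxx mulr1.
Qed.

Lemma aff_line z x v t : aff z (x + t *: v) = aff z x + t * lin z v.
Proof. by rewrite point_line pairingDr pairingZr. Qed.

Lemma linN z v : lin z (- v) = - lin z v.
Proof.
have -> : dir (- v) = -1 *: dir v by rewrite /dir scale_col_mx scaler0 scaleN1r.
by rewrite pairingZr mulN1r.
Qed.

Lemma aff_segment z x y t :
  aff z (x + t *: (y - x)) = aff z x + t * (aff z y - aff z x).
Proof.
have := aff_line z x (y - x) 1; rewrite scale1r addrC subrK mul1r aff_line => ->.
by rewrite addrAC subrr add0r.
Qed.

(** The hypothesis is applied to the columns of [cokermx z0], which [z0] annihilates. For row
    vectors, [(z <= z0)%MS] says that [z] is a scalar multiple of [z0]. *)
Lemma pairing_sub (z0 z : 'rV[R]_(1 + d)) :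
  (forall X, pairing z0 X = 0 -> pairing z X = 0) -> (z <= z0)%MS.
Proof.
move=> H; rewrite submxE; apply/eqP/rowP => j.
have /H : pairing z0 (col j (cokermx z0)) = 0.
  have /rowP/(_ j) := mulmx_coker z0; rewrite /pairing !mxE => h.
  by rewrite -[RHS]h; apply: eq_bigr => i _; rewrite !mxE.
by rewrite /pairing !mxE => h; rewrite -[RHS]h; apply: eq_bigr => i _; rewrite !mxE.
Qed.

Lemma aff_sub (z0 z : 'rV[R]_(1 + d)) x : aff z0 x = 0 -> aff z x = 0 ->
  (forall v, lin z0 v = 0 -> lin z v = 0) -> (z <= z0)%MS.
Proof.
move=> z0x zx H; apply: pairing_sub => X.
have [c [v ->]] := point_dirP x X.
by rewrite !pairingDr !pairingZr z0x zx mulr0 !add0r; exact: H.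
Qed.

Lemma open_cube_sub B x : open_cube B x -> cube d B x.
Proof. by move=> Bx i; rewrite -ler_norml ltW. Qed.

Lemma line_cvg (b c : R) : b + t * c @[t --> (0 : R)] --> b.
Proof.
rewrite -[X in _ --> X]addr0; apply: cvgD; first exact: cvg_cst.
by rewrite -[X in _ --> X](mul0r c); apply: cvgMr_tmp; exact: cvg_id.
Qed.

Lemma open_cube_near B x v : open_cube B x ->
  \forall t \near (0 : R), open_cube B (x + t *: v).
Proof.
move=> Bx.
suff : \forall t \near (0 : R), forall i, `|(x + t *: v) i ord0| < B by [].
apply: (@filter_forall R _ (fun i t => `|(x + t *: v) i ord0| < B) (nbhs (0 : R)) _) => i.
have := @line_cvg (x i ord0) (v i ord0).
move=> /cvg_norm /cvgr_lt /(_ _ (Bx i)).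
by apply: filterS => t; rewrite !mxE.
Qed.

Lemma sgr_near (T : Type) (F : set_system T) {FF : Filter F} (g : T -> R) (l : R) :
  l != 0 -> g t @[t --> F] --> l -> \forall t \near F, Num.sg (g t) = Num.sg l.
Proof.
rewrite neq_lt => /orP[l0|l0] gl.
  apply: (@filterS _ F _ _ _ _ (cvgr_lt l gl 0 l0)) => t gt0.
  by rewrite !ltr0_sg.
apply: (@filterS _ F _ _ _ _ (cvgr_gt l gl 0 l0)) => t gt0.
by rewrite !gtr0_sg.
Qed.

Lemma sg_aff_near z x v : aff z x != 0 ->
  \forall t \near (0 : R), Num.sg (aff z (x + t *: v)) = Num.sg (aff z x).
Proof.
move=> zx.
apply: (@sgr_near R (nbhs (0 : R)) _ (fun t => aff z (x + t *: v))) => //.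
by under eq_fun do rewrite aff_line; exact: line_cvg.
Qed.

(** The point is moved within the zero set of [z0] off one further zero set at a time, by steps
    small enough to keep what is already achieved. *)
Lemma generic_zero B (I : finType) (z : I -> 'rV[R]_(1 + d))
    (z0 : 'rV[R]_(1 + d)) x0 :
  open_cube B x0 -> aff z0 x0 = 0 ->
  exists x, [/\ open_cube B x, aff z0 x = 0 &
     forall i, ~~ (z i <= z0)%MS -> aff (z i) x != 0].
Proof.
move=> Bx0 z0x0.
suff [x [Bx z0x /allP zx]] : exists x, [/\ open_cube B x, aff z0 x = 0 &
    all (fun i => (z i <= z0)%MS || (aff (z i) x != 0)) (enum I)].
  exists x; split=> // i iz0; have := zx i (mem_enum I i).
  by rewrite (negPf iz0).
elim: (enum I) => [|k s [x [Bx z0x sx]]]; first by exists x0; split.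
have [|] := boolP ((z k <= z0)%MS || (aff (z k) x != 0)) => [kx|].
  by exists x; split=> //=; rewrite kx.
rewrite negb_or negbK => /andP[kz0 /eqP zkx].
have [v [z0v zkv]] : exists v, lin z0 v = 0 /\ lin (z k) v != 0.
  apply: contrapT => H; move/negP: kz0; apply; apply: (aff_sub z0x zkx) => v z0v.
  by apply/eqP/negP => /negP zkv; apply: H; exists v.
have near_s : \forall t \near (0 : R),
    all (fun i => (z i <= z0)%MS || (aff (z i) (x + t *: v) != 0)) s.
  elim: s sx => [_|i s IH /= /andP[zi /IH {}IH]]; first exact: filterE.
  case/orP: zi => [iz0|zi]; first by apply: filterS IH => t ->; rewrite iz0.
  have := sg_aff_near v zi; apply: filterS2 IH => t -> sg_eq.
  by rewrite -sgr_eq0 sg_eq sgr_eq0 zi orbT.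
have [t [Bt st t0]] : exists t, [/\ open_cube B (x + t *: v),
    all (fun i => (z i <= z0)%MS || (aff (z i) (x + t *: v) != 0)) s & t != 0].
  near (0 : R)^' => t; exists t; split; near: t.
  - exact: nbhs_dnbhs (open_cube_near v Bx).
  - exact: nbhs_dnbhs near_s.
  - exact: nbhs_dnbhs_neq.
exists (x + t *: v); split => //; first by rewrite aff_line z0x z0v mulr0 addr0.
by rewrite /= st andbT aff_line zkx add0r mulf_neq0 ?orbT.
Unshelve. all: by end_near. Qed.

End AffineFunctions.

(** * Limits along filters and ultrafilters *)

Section Limits.
Set Implicit Arguments.
Unset Strict Implicit.
Variable R : realType.

Lemma cvg_sumr (T : Type) (F : set_system T) {FF : Filter F} (I : finType)
    (P : pred I) (g : I -> T -> R) (l : I -> R) :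
  (forall i, P i -> g i t @[t --> F] --> l i) ->
  \sum_(i | P i) g i t @[t --> F] --> \sum_(i | P i) l i.
Proof. by move=> gl; apply: cvg_big => //; exact: add_continuous. Qed.

(** Compactness of [[-M, M]] gives a cluster point, and an ultrafilter converges to each of its
    cluster points. *)
Lemma ultra_bounded_cvg (T : Type) (F : set_system T) (u : T -> R) (M : R) :
  UltraFilter F -> (forall t, `|u t| <= M) -> exists l : R, u t @[t --> F] --> l.
Proof.
move=> UF uM.
have FF : ProperFilter F by exact: ultra_proper.
have [|l [_ ul]] := @segment_compact R (- M) M (fmap u F) _.
  by apply: (@filterE _ F) => t; rewrite /= in_itv /= -ler_norml.
exists l => V lV.
case: (in_ultra_setVsetC (u @^-1` V) UF) => // nV.
by have [r [nVr Vr]] := ul (~` V) V nV lV.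
Qed.

(** Carries a formula for [f] that is valid just after [x] on a ray over to [x] itself, which may
    lie on the boundary of [A]. *)
Lemma path_limit d (A : set 'cV[R]_d) (f : 'cV[R]_d -> R) (x v : 'cV[R]_d)
    (g : R -> R) (l : R) :
  {within A, continuous f} -> A x ->
  (\forall t \near 0^'+, A (x + t *: v) /\ f (x + t *: v) = g t) ->
  g t @[t --> (0 : R)] --> l -> f x = l.
Proof.
move=> fA Ax fg gl.
have xv : x + t *: v @[t --> (0 : R)^'+] --> x.
  apply: cvg_at_right_filter; rewrite -[X in _ --> X]addr0.
  apply: cvgD; first exact: cvg_cst.
  by rewrite -[X in _ --> X](scale0r v); apply: cvgZr_tmp; exact: cvg_id.
have fx : f (x + t *: v) @[t --> (0 : R)^'+] --> f x.
  move=> V /fA; rewrite -[nbhs _ _]/(nbhs_subspace (A := A) x _) -(nbhs_subspace_in Ax).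
  rewrite /within /= => /xv VA.
  have AV : \forall t \near (0 : R)^'+, A (x + t *: v) -> V (f (x + t *: v)) by exact: VA.
  suff : \forall t \near (0 : R)^'+, V (f (x + t *: v)) by [].
  by apply: filterS2 fg AV => t [At _]; apply.
apply: (@cvg_unique _ _ _ _ _ _ fx); first exact: norm_hausdorff.
have gl' := cvg_at_right_filter gl.
by apply: cvg_trans gl'; apply: near_eq_cvg; apply: filterS fg => t [].
Qed.

Lemma weak_limit d (U : set_system nat) {UF : ProperFilter U}
    (u : nat -> 'rV[R]_(1 + d)) :
  (forall X, exists l : R, pairing (u n) X @[n --> U] --> l) ->
  exists ul, forall X, pairing (u n) X @[n --> U] --> pairing ul X.
Proof.
move=> /choice[l ul]; exists (\row_j l (delta_mx j ord0)) => X.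
under eq_fun do rewrite pairingE; rewrite pairingE.
apply: cvg_sumr => j _; rewrite mxE; apply: cvgMr_tmp.
by under eq_fun do rewrite -pairing_delta; exact: ul.
Qed.

End Limits.

(** * Limits of affine functions plus multiples of absolute values *)

Section Kinks.
Set Implicit Arguments.
Unset Strict Implicit.
Variables (R : realType) (d m : nat) (B : R).
Variables (U : set_system nat) (UF : ProperFilter U).
Variables (z : 'I_m -> nat -> 'rV[R]_(1 + d)) (zl : 'I_m -> 'rV[R]_(1 + d)).
Variables (k : 'I_m -> nat -> R) (L : nat -> 'rV[R]_(1 + d)) (f : 'cV[R]_d -> R).
Hypotheses (B_gt0 : 0 < B) (zl_neq0 : forall i, zl i != 0)
  (z_cvg : forall i X, pairing (z i n) X @[n --> U] --> pairing (zl i) X)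
  (f_cont : {within cube d B, continuous f})
  (f_cvg : forall x, cube d B x ->
     aff (L n) x + \sum_i k i n * `|aff (z i n) x| @[n --> U] --> f x).
Implicit Types (x y p q v w : 'cV[R]_d) (i j : 'I_m).

Let sgn x i := Num.sg (aff (zl i) x).
Let generic x := open_cube B x /\ forall i, aff (zl i) x != 0.

(* The affine function with which the [n]-th network eventually agrees near
   a point where the limit functions [zl i] have the signs [s i]. *)
Let piece (s : 'I_m -> R) n := L n + \sum_i (k i n * s i) *: z i n.

Lemma pairing_piece s n X :
  pairing (piece s n) X = pairing (L n) X + \sum_i k i n * s i * pairing (z i n) X.
Proof.
rewrite /piece pairingDl pairing_suml; congr (_ + _).
by apply: eq_bigr => i _; rewrite pairingZl.
Qed.

Lemma open_cube_convex x q t : cube d B x -> open_cube B q -> 0 < t -> t <= 1 ->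
  open_cube B (x + t *: (q - x)).
Proof.
move=> Bx Bq t0 t1 i; rewrite !mxE.
have := Bx i; have := Bq i; rewrite -ler_norml => qi xi.
have -> : x i ord0 + t * (q i ord0 - x i ord0) =
  (1 - t) * x i ord0 + t * q i ord0 by rewrite mulrBl mul1r mulrBr addrA addrAC.
apply: le_lt_trans (ler_normD _ _) _.
rewrite !normrM (ger0_norm (ltW t0)) ger0_norm ?subr_ge0//.
rewrite -[ltRHS](subrK (t * B)) -[X in X - _ + _]mul1r -mulrBl.
by rewrite ler_ltD ?ler_wpM2l ?subr_ge0 ?ltr_pM2l.
Qed.

Lemma generic_near x v : generic x -> \forall t \near (0 : R),
  generic (x + t *: v) /\ forall i, sgn (x + t *: v) i = sgn x i.
Proof.
move=> [Bx gx].
have sx : \forall t \near (0 : R), forall i, sgn (x + t *: v) i = sgn x i.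
  apply: (@filter_forall R _ (fun i t => sgn (x + t *: v) i = sgn x i)
    (nbhs (0 : R)) _) => i.
  exact: sg_aff_near.
apply: filterS2 (open_cube_near v Bx) sx => t Bt st; split => //; split => // i.
by have := st i; rewrite /sgn => si; rewrite -sgr_eq0 si sgr_eq0.
Qed.

(** At a generic point the signs of the [z i n] are eventually those of their limits, which resolves
    the absolute values. *)
Lemma piece_cvg_point x : generic x -> aff (piece (sgn x) n) x @[n --> U] --> f x.
Proof.
move=> [Bx gx]; apply: cvg_trans (f_cvg (open_cube_sub Bx)).
apply: near_eq_cvg.
have : \forall n \near U, forall i, Num.sg (aff (z i n) x) = sgn x i.
  apply: (@filter_forall nat _ (fun i n => Num.sg (aff (z i n) x) = sgn x i) U _) => i.
  exact: (@sgr_near R nat U _ (fun n => aff (z i n) x)).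
apply: filterS => n sx; rewrite pairing_piece; congr (_ + _).
by apply: eq_bigr => i _; rewrite normrEsg sx mulrA.
Qed.

(** Generic points with the signs of [q] share its piece, and these include small shifts of [q] in
    every direction. So the values and difference quotients at [q] converge, and they determine the
    pairing with every [X]. *)
Lemma piece_cvg q : generic q -> exists Al,
  (forall X, pairing (piece (sgn q) n) X @[n --> U] --> pairing Al X) /\
  forall x, generic x -> sgn x =1 sgn q -> f x = aff Al x.
Proof.
move=> gq.
have cell x : generic x -> sgn x =1 sgn q ->
    aff (piece (sgn q) n) x @[n --> U] --> f x.
  by move=> gx /funext <-; exact: piece_cvg_point.
have [X|Al cvgAl] := @weak_limit R d U UF (piece (sgn q)).
  have [c [v ->]] := point_dirP q X.
  have [t [[gt st] t0]] : exists t : R, (generic (q + t *: v) /\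
      forall i, sgn (q + t *: v) i = sgn q i) /\ t != 0.
    near (0 : R)^' => t; exists t; split; near: t.
    - exact: nbhs_dnbhs (generic_near v gq).
    - exact: nbhs_dnbhs_neq.
  exists (c * f q + t^-1 * (f (q + t *: v) - f q)).
  have -> : (fun n => pairing (piece (sgn q) n) (c *: point q + dir v)) =
     (fun n => c * aff (piece (sgn q) n) q +
       t^-1 * (aff (piece (sgn q) n) (q + t *: v) - aff (piece (sgn q) n) q)).
    apply/funext => n; rewrite pairingDr pairingZr; congr (_ + _).
    by rewrite aff_line addrAC subrr add0r mulKf.
  apply: cvgD; apply: cvgMl_tmp; first exact: cell.
  by apply: cvgB; exact: cell.
exists Al; split=> // x gx sx.
by apply: (@cvg_unique _ (@norm_hausdorff _ _) _ _ _ _ (cell x gx sx)); exact: cvgAl.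
Unshelve. all: by end_near. Qed.

Lemma sgn_near j y v : (forall i, ~~ (zl i <= zl j)%MS -> aff (zl i) y != 0) ->
  \forall t \near (0 : R), forall i, ~~ (zl i <= zl j)%MS ->
    sgn (y + t *: v) i = sgn y i.
Proof.
move=> gy; apply: (@filter_forall R _ (fun i t => ~~ (zl i <= zl j)%MS ->
  sgn (y + t *: v) i = sgn y i) (nbhs (0 : R)) _) => i.
have [ij|ij] := boolP (zl i <= zl j)%MS; first exact: filterE.
by apply: filterS (sg_aff_near v (gy i ij)) => t si _.
Qed.

(** Along [w], transverse to the zero set of [zl j], each multiple of [zl j] takes the sign of its
    derivative, and every other [zl i] keeps its nonzero sign at [y]. *)
Lemma side_near j y w : open_cube B y -> aff (zl j) y = 0 ->
  (forall i, ~~ (zl i <= zl j)%MS -> aff (zl i) y != 0) -> lin (zl j) w != 0 ->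
  \forall t \near (0 : R)^'+, generic (y + t *: w) /\ forall i,
    sgn (y + t *: w) i = if (zl i <= zl j)%MS then Num.sg (lin (zl i) w) else sgn y i.
Proof.
move=> By jy gy jw.
have t0 : \forall t \near (0 : R)^'+, 0 < t by exact: nbhs_right_gt.
have Bst : \forall t \near (0 : R)^'+, open_cube B (y + t *: w) /\
     forall i, ~~ (zl i <= zl j)%MS -> sgn (y + t *: w) i = sgn y i.
  by apply: cvg_within; apply: filterI; [exact: open_cube_near|exact: sgn_near].
apply: filterS2 t0 Bst => t t0 [Bt sty].
have sE i : sgn (y + t *: w) i =
    if (zl i <= zl j)%MS then Num.sg (lin (zl i) w) else sgn y i.
  case: ifPn => [/sub_rVP[a ia]|]; last exact: sty.
  by rewrite /sgn aff_line ia pairingZl jy mulr0 add0r sgrM gtr0_sg// mul1r.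
split => //; split => // i; rewrite -sgr_eq0 -/(sgn _ i) sE.
case: ifPn => [/sub_rVP[a ia]|/gy]; last by rewrite sgr_eq0.
rewrite sgr_eq0 ia pairingZl mulf_neq0//.
by apply: contraNneq (zl_neq0 i) => a0; rewrite ia a0 scale0r.
Qed.

Lemma f_limit x v A : cube d B x ->
  (\forall t \near (0 : R)^'+, generic (x + t *: v) /\
     f (x + t *: v) = aff A (x + t *: v)) ->
  f x = aff A x.
Proof.
move=> Bx gf; apply: (path_limit f_cont Bx (v := v) (g := fun t => aff A (x + t *: v))).
  by apply: filterS gf => t [[Bt _] ft]; split => //; exact: open_cube_sub.
by under eq_fun do rewrite aff_line; exact: line_cvg.
Qed.

(* The limits of the pieces on the two sides of the zero set of [zl j] agree
   on that set by continuity of [f], so their difference is proportional to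
   [zl j], although the coefficients [k i] of the class of [j] may diverge. *)
Lemma kink_cvg j : (exists p, open_cube B p /\ aff (zl j) p = 0) ->
  exists c, forall q, generic q -> forall X,
    \sum_(i | (zl i <= zl j)%MS) k i n * sgn q i * pairing (z i n) X @[n --> U]
      --> c * sgn q j * pairing (zl j) X.
Proof.
move=> [p0 [Bp0 jp0]].
have [p [Bp jp gp]] := generic_zero zl Bp0 jp0.
have [w jw] : exists w, lin (zl j) w != 0.
  apply: contrapT => H; move/negP: (zl_neq0 j); apply.
  suff /sub_rVP[c ->] : (zl j <= (0 : 'rV[R]_(1 + d)))%MS by rewrite scaler0.
  apply: (@aff_sub _ _ 0 (zl j) p) => [|//|v _]; first exact: pairing0l.
  by apply/eqP/negP => /negP jv; apply: H; exists v.
(* Near [p], these points fill the zero set of [zl j]. *)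
pose good y := [/\ open_cube B y, aff (zl j) y = 0 &
  forall i, ~~ (zl i <= zl j)%MS -> sgn y i = sgn p i].
have good_p : good p by split.
have good_neq y i : good y -> ~~ (zl i <= zl j)%MS -> aff (zl i) y != 0.
  by move=> [_ _ sy] ij; rewrite -sgr_eq0 -/(sgn y i) sy// sgr_eq0 gp.
have good_near v : lin (zl j) v = 0 -> \forall t \near (0 : R), good (p + t *: v).
  move=> jv.
  apply: filterS2 (open_cube_near v Bp) (sgn_near v gp) => t Bt st; split => //.
  by rewrite aff_line jp jv mulr0 addr0.
(* The signs just off that zero set, on the side to which [v] points. *)
pose side v i := if (zl i <= zl j)%MS then Num.sg (lin (zl i) v) else sgn p i.
have side_piece v : lin (zl j) v != 0 -> exists A,
    (forall X, pairing (piece (side v) n) X @[n --> U] --> pairing A X) /\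
    forall y, good y -> f y = aff A y.
  move=> jv.
  have near_side y : good y -> \forall t \near (0 : R)^'+,
      generic (y + t *: v) /\ sgn (y + t *: v) =1 side v.
    move=> gy; have [By jy sy] := gy.
    have := side_near By jy (fun i => good_neq y i gy) jv.
    apply: filterS => t [gt st]; split => // i.
    by rewrite st /side; case: ifPn => // /sy.
  have [t [gt /funext st]] : exists t : R,
      generic (p + t *: v) /\ sgn (p + t *: v) =1 side v.
    have := near_side p good_p; exact: filter_ex.
  have [A [cvgA fA]] := piece_cvg gt; rewrite st in cvgA fA.
  exists A; split => // y gy; have [By _ _] := gy.
  apply: (@f_limit _ v); first exact: open_cube_sub.
  by apply: filterS (near_side y gy) => s [gs ss]; split => //; exact: fA.
have [A1 [cvgA1 fA1]] := side_piece w jw.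
have [|A2 [cvgA2 fA2]] := side_piece (- w); first by rewrite linN oppr_eq0.
(* Both limits equal [f] at good points, so [A1 - A2] vanishes at [p] and in every direction tangent
   to the zero set. *)
have /sub_rVP[c A12] : (A1 - A2 <= zl j)%MS.
  have A0 y : good y -> aff (A1 - A2) y = 0.
    by move=> gy; rewrite pairingBl -fA1// -fA2// subrr.
  apply: (aff_sub jp); first exact: A0.
  move=> v jv; have [t [gt t0]] : exists t : R, good (p + t *: v) /\ t != 0.
    near (0 : R)^' => t; exists t; split; near: t.
    - exact: nbhs_dnbhs (good_near v jv).
    - exact: nbhs_dnbhs_neq.
  have := A0 _ gt; rewrite aff_line (A0 _ good_p) add0r => /eqP.
  by rewrite mulf_eq0 (negPf t0) /= => /eqP.
pose e := Num.sg (lin (zl j) w).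
(* The pieces for [w] and [- w] differ by twice the sum over the class of [j], taken with the signs
   on the side of [w]; the factor [e * sgn q j] turns these into the signs at [q]. *)
exists (c * e / 2) => q [Bq gq] X.
have -> : c * e / 2 * sgn q j * pairing (zl j) X =
    e / 2 * sgn q j * (pairing A1 X - pairing A2 X).
  rewrite -pairingBl A12 pairingZl; ring.
suff -> : (fun n => \sum_(i | (zl i <= zl j)%MS) k i n * sgn q i * pairing (z i n) X) =
   (fun n => e / 2 * sgn q j *
     (pairing (piece (side w) n) X - pairing (piece (side (- w)) n) X)).
  by apply: cvgMl_tmp; apply: cvgB.
apply/funext => n; rewrite !pairing_piece opprD addrACA subrr add0r -sumrB mulr_sumr.
rewrite [RHS](bigID (fun i => (zl i <= zl j)%MS)) /= [X in _ = _ + X]big1 ?addr0.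
  apply: eq_bigr => i ij; rewrite /side ij linN sgrN.
  have /sub_rVP[a ia] := ij.
  have a0 : a != 0 by apply: contraNneq (zl_neq0 i) => a0; rewrite ia a0 scale0r.
  have -> : sgn q i = Num.sg a * sgn q j by rewrite /sgn ia pairingZl sgrM.
  have -> : Num.sg (lin (zl i) w) = Num.sg a * e by rewrite ia pairingZl sgrM.
  have e2 : e * e = 1 by rewrite -expr2 sqr_sg jw.
  transitivity (k i n * (Num.sg a * sgn q j) * pairing (z i n) X * (e * e)).
    by rewrite e2 mulr1.
  by field.
by move=> i ij; rewrite /side (negPf ij) subrr mulr0.
Unshelve. all: by end_near. Qed.

(** * Grouping the indices by limit hyperplane *)

Let crossing i := `[< exists p, open_cube B p /\ aff (zl i) p = 0 >].
(** Proportional limits define the same predicate, hence get the same representative from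
    [choose]. *)
Let rep i := choose (fun l => (zl l <= zl i)%MS) i.

(** An affine function with opposite signs at two points vanishes on the segment between them, which
    lies in the open cube. *)
Lemma same_sgn i x q : ~~ crossing i -> generic x -> generic q -> sgn x i = sgn q i.
Proof.
move=> /asboolPn ni [Bx gx] [Bq gq].
have [//|sxq] := eqVneq (sgn x i) (sgn q i); case: ni.
pose a := aff (zl i) x; pose b := aff (zl i) q.
have [t [t0 t1 abt]] : exists t : R, [/\ 0 < t, t <= 1 & a + t * (b - a) = 0].
  move: sxq (gx i) (gq i); rewrite /sgn -/a -/b => sab a0 b0.
  have ab : a - b != 0 by apply: contraNneq sab => /eqP; rewrite subr_eq0 => /eqP ->.
  exists (a / (a - b)); split; last by field.
  - move: a0 b0 sab; rewrite !neq_lt => /orP[] ha /orP[] hb;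
      rewrite ?(gtr0_sg ha) ?(gtr0_sg hb) ?(ltr0_sg ha) ?(ltr0_sg hb) ?ltxx// => _.
    + by rewrite -mulrNN -invrN divr_gt0//; lra.
    + by rewrite divr_gt0//; lra.
  - move: a0 b0 sab; rewrite !neq_lt => /orP[] ha /orP[] hb;
      rewrite ?(gtr0_sg ha) ?(gtr0_sg hb) ?(ltr0_sg ha) ?(ltr0_sg hb) ?ltxx// => _.
    + by rewrite -mulrNN -invrN ler_pdivrMr; lra.
    + by rewrite ler_pdivrMr; lra.
exists (x + t *: (q - x)); split; last by rewrite aff_segment.
by apply: open_cube_convex => //; exact: open_cube_sub.
Qed.

Lemma sub_sym i l : (zl i <= zl l)%MS -> (zl l <= zl i)%MS.
Proof.
move=> /sub_rVP[a ia].
have a0 : a != 0 by apply: contraNneq (zl_neq0 i) => a0; rewrite ia a0 scale0r.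
by apply/sub_rVP; exists a^-1; rewrite ia scalerA mulVf// scale1r.
Qed.

Lemma crossing_sub i j : (zl i <= zl j)%MS -> crossing j -> crossing i.
Proof.
move=> /sub_rVP[a ia] /asboolP[p [Bp jp]]; apply/asboolP; exists p; split => //.
by rewrite ia pairingZl jp mulr0.
Qed.

Lemma rep_sub i : (zl (rep i) <= zl i)%MS.
Proof. exact: (@chooseP _ (fun l => (zl l <= zl i)%MS) i). Qed.

Lemma rep_eq i j : (zl i <= zl j)%MS -> rep i = rep j.
Proof.
move=> ij; rewrite /rep (@eq_choose _ _ (fun l => (zl l <= zl j)%MS)) => [|l].
  exact: choose_id.
by apply/idP/idP => h; apply: submx_trans h _ => //; exact: sub_sym.
Qed.

(** One index for each limit hyperplane that crosses the open cube. *)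
Let kinks : pred 'I_m := fun j => (rep j == j) && crossing j.

Lemma rep_kinks i : crossing i -> kinks (rep i).
Proof.
move=> ic; rewrite /kinks (rep_eq (rep_sub i)) eqxx /=.
exact: crossing_sub (rep_sub i) ic.
Qed.

Lemma kinksP i j : kinks j -> (crossing i && (rep i == j)) = (zl i <= zl j)%MS.
Proof.
move=> /andP[/eqP jj jc]; apply/andP/idP => [[_ /eqP <-]|ij].
  exact: sub_sym (rep_sub i).
by split; [exact: crossing_sub ij jc|rewrite (rep_eq ij) jj].
Qed.

Lemma exists_generic : exists q, generic q.
Proof.
(* With [z0 = 0] the vanishing condition is void, and no nonzero [zl i] is a multiple of [z0]. *)
have [|q [Bq _ gq]] := @generic_zero _ _ B _ zl 0 0 _ (pairing0l _).
  by move=> i; rewrite mxE normr0.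
exists q; split => // i; apply: gq.
by apply: contra (zl_neq0 i) => /sub_rVP[a ->]; rewrite scaler0.
Qed.

(** The piece at a generic [x] is compared with that at a fixed generic [q]. Terms whose limit does
    not cross the open cube have equal signs and cancel; the others are summed class by class, and
    [kink_cvg] gives the limit of each class sum. *)
Lemma kinks_structure : exists L' (c : 'I_m -> R), forall x, cube d B x ->
  f x = aff L' x + \sum_(j | kinks j) c j * `|aff (zl j) x|.
Proof.
have [q gq] := exists_generic.
have /choice[c cP] j : exists c, crossing j -> forall q, generic q -> forall X,
    \sum_(i | (zl i <= zl j)%MS) k i n * sgn q i * pairing (z i n) X @[n --> U]
      --> c * sgn q j * pairing (zl j) X.
  have [/asboolP/kink_cvg[c cc]|_] := boolP (crossing j); first by exists c.
  by exists 0.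
have [A [cvgA _]] := piece_cvg gq.
(* From [A] are subtracted the absolute values as they are resolved at [q]. *)
exists (A - \sum_(j | kinks j) (c j * sgn q j) *: zl j), c.
set L' := A - _.
have Jx x : generic x -> f x = aff L' x + \sum_(j | kinks j) c j * `|aff (zl j) x|.
  move=> gx; have fx := piece_cvg_point gx.
  apply: (@cvg_unique _ (@norm_hausdorff _ _) _ _ _ _ fx).
  have -> : aff L' x + \sum_(j | kinks j) c j * `|aff (zl j) x| = aff A x +
     \sum_(j | kinks j) (c j * sgn x j * aff (zl j) x - c j * sgn q j * aff (zl j) x).
    rewrite /L' pairingBl pairing_suml -addrA; congr (_ + _).
    rewrite sumrB addrC; congr (_ - _); apply: eq_bigr => j _.
      by rewrite normrEsg mulrA.
    by rewrite pairingZl.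
  have -> : (fun n => aff (piece (sgn x) n) x) = (fun n => aff (piece (sgn q) n) x +
     \sum_(j | kinks j) (\sum_(i | (zl i <= zl j)%MS) k i n * sgn x i * aff (z i n) x -
        \sum_(i | (zl i <= zl j)%MS) k i n * sgn q i * aff (z i n) x)).
    apply/funext => n; rewrite !pairing_piece -addrA; congr (_ + _).
    apply/eqP; rewrite addrC -subr_eq; apply/eqP; rewrite -sumrB.
    rewrite (bigID crossing) /= [X in _ + X]big1 ?addr0 => [|i ic]; last first.
      by rewrite (same_sgn ic gx gq) subrr.
    rewrite (partition_big rep kinks) /= => [|i ic]; last exact: rep_kinks.
    apply: eq_bigr => j jk; rewrite -sumrB.
    by apply: eq_bigl => i; exact: kinksP.
  apply: cvgD; first exact: cvgA.
  apply: cvg_sumr => j /andP[_ jc]; apply: cvgB; exact: cP.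
(* Any point of the cube is a limit of generic points along the segment to [q]. *)
move=> x Bx.
apply: (path_limit f_cont Bx (v := q - x) (g := fun t => aff L' (x + t *: (q - x)) +
   \sum_(j | kinks j) c j * `|aff (zl j) (x + t *: (q - x))|)).
  have gt : \forall t \near (0 : R)^'+, generic (x + t *: (q - x)).
    have nz : \forall t \near (0 : R)^'+, forall i, aff (zl i) (x + t *: (q - x)) != 0.
      apply: (@filter_forall R _ (fun i t => aff (zl i) (x + t *: (q - x)) != 0)
        ((0 : R)^'+) _) => i.
      have [xi|xi] := eqVneq (aff (zl i) x) 0.
        have : \forall t \near (0 : R)^'+, 0 < t by exact: nbhs_right_gt.
        apply: filterS => t t0; rewrite aff_segment xi add0r subr0.
        by case: gq => _ gq; rewrite mulf_neq0 ?gq// gt_eqF.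
      apply: cvg_within; apply: filterS (sg_aff_near (q - x) xi) => t st.
      by rewrite -sgr_eq0 st sgr_eq0.
    have t0 : \forall t \near (0 : R)^'+, 0 < t by exact: nbhs_right_gt.
    have t1 : \forall t \near (0 : R)^'+, t <= 1 by apply: nbhs_right_le.
    apply: filterS3 t0 t1 nz => t t0 t1 nz; split => //.
    by case: gq => Bq _; exact: open_cube_convex.
  apply: filterS gt => t gt; split; last exact: Jx.
  by have [Bt _] := gt; exact: open_cube_sub.
have affc (u : 'rV[R]_(1 + d)) :
    aff u (x + t *: (q - x)) @[t --> (0 : R)] --> aff u x.
  by under eq_fun do rewrite aff_line; exact: line_cvg.
apply: cvgD => //; apply: cvg_sumr => j _; apply: cvgMl_tmp.
by apply: cvg_norm.
Qed.

(** Each class is a single index here, so the class sum in [kink_cvg] has one term, which is divided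
    by a factor with nonzero limit. *)
Lemma coef_cvg : (forall i, kinks i) ->
  exists c : 'I_m -> R, forall i, k i n @[n --> U] --> c i.
Proof.
move=> all_kinks; have [q gq] := exists_generic.
suff kc i : exists l : R, k i n @[n --> U] --> l by have [c cc] := choice kc; exists c.
have rep_id j : rep j = j by have /andP[/eqP] := all_kinks j.
have /andP[_ /asboolP/kink_cvg[c /(_ q gq (point q))]] := all_kinks i.
have -> : (fun n => \sum_(l | (zl l <= zl i)%MS) k l n * sgn q l * aff (z l n) q) =
    (fun n => k i n * sgn q i * aff (z i n) q).
  apply/funext => n; apply: big_pred1 => j.
  apply/idP/eqP => [/rep_eq|->]; last exact: submx_refl.
  by rewrite !rep_id.
have [_ /(_ i) iq] := gq; move=> kz; exists c.
have z0 := @z_cvg i (point q).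
have s0 : sgn q i != 0 by rewrite sgr_eq0.
have -> : c = c * sgn q i * aff (zl i) q * (sgn q i * aff (zl i) q)^-1.
  by field; rewrite s0 iq.
have cV : (sgn q i * aff (z i n) q)^-1 @[n --> U] --> (sgn q i * aff (zl i) q)^-1.
  by apply: cvgV; [rewrite mulf_neq0|apply: cvgMl_tmp].
apply: cvg_trans (cvgM kz cV); apply: near_eq_cvg.
apply: (filterS _ (@sgr_near R nat U _ (fun n => aff (z i n) q) _ iq z0)) => n zn.
have zn0 : aff (z i n) q != 0 by rewrite -sgr_eq0 zn.
by rewrite /=; field; rewrite s0 zn0.
Qed.

(** An index outside [kinks] gets coefficient zero and will leave a neuron free; if there is none,
    [coef_cvg] applies. *)
Lemma limit_structure : exists L' (c : 'I_m -> R),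
  (forall x, cube d B x -> f x = aff L' x + \sum_j c j * `|aff (zl j) x|) /\
  ((exists i, c i = 0) \/
   (exists c' : 'I_m -> R, forall i, k i n @[n --> U] --> c' i)).
Proof.
have [L' [c fE]] := kinks_structure.
exists L', (fun j => if kinks j then c j else 0); split => [x Bx|].
  rewrite fE// big_mkcond; congr (_ + _); apply: eq_bigr => j _.
  by case: ifP => // _; rewrite mul0r.
have [/forallP/coef_cvg|] := boolP [forall i, kinks i]; first by right.
by rewrite negb_forall => /existsP[i /negPf ik]; left; exists i; rewrite ik.
Qed.

End Kinks.

(** * Shallow networks with the parametric ReLU *)

Section Networks.
Set Implicit Arguments.
Unset Strict Implicit.
Variables (R : realType) (d N0 : nat) (B a : R).
Hypothesis a_ge0 : 0 <= a.
Implicit Types (x : 'cV[R]_d) (z : 'rV[R]_(1 + d)).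

Lemma preluE (x : R) : prelu a x = (1 + a) / 2 * x + `|1 - a| / 2 * `|x|.
Proof.
have -> : `|1 - a| / 2 * `|x| = `|x - a * x| / 2.
  by rewrite -[X in X - a * x]mul1r -mulrBl normrM; field.
by rewrite /prelu maxr_absE; field.
Qed.

Lemma preluZ (t x : R) : 0 <= t -> prelu a (t * x) = t * prelu a x.
Proof. by move=> t0; rewrite !preluE normrM (ger0_norm t0); field. Qed.

Lemma prelu_cvg (T : Type) (F : set_system T) {FF : Filter F} (g : T -> R) (l : R) :
  g t @[t --> F] --> l -> prelu a (g t) @[t --> F] --> prelu a l.
Proof.
move=> gl; under eq_fun do rewrite preluE; rewrite preluE.
by apply: cvgD; apply: cvgMl_tmp => //; exact: cvg_norm.
Qed.

Lemma affE z x :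
  aff z x = \sum_j z ord0 (rshift 1 j) * x j ord0 + z ord0 (lshift d ord0).
Proof.
rewrite pairingE big_split_ord big_ord1 /= addrC /point.
rewrite col_mxEu mxE eqxx mulr1; congr (_ + _).
by apply: eq_bigr => j _; rewrite col_mxEd.
Qed.

Definition const_aff (c : R) : 'rV[R]_(1 + d) := row_mx c%:M 0.

Lemma aff_const c x : aff (const_aff c) x = c.
Proof.
rewrite affE /const_aff row_mxEl mxE eqxx mulr1n big1 ?add0r// => j _.
by rewrite row_mxEr mxE mul0r.
Qed.

Lemma RNNP (f : 'cV[R]_d -> R) : RNN d N0 a B f <->
  exists (c : 'I_N0 -> R) (z : 'I_N0 -> 'rV[R]_(1 + d)) (b : R),
    forall x, cube d B x -> f x = \sum_i c i * prelu a (aff (z i) x) + b.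
Proof.
have netE A1 b1 A2 b2 x : shallow_net d N0 a A1 b1 A2 b2 x =
    \sum_i A2 ord0 i * prelu a (\sum_j A1 i j * x j ord0 + b1 i ord0) + b2.
  by rewrite /shallow_net mxE; congr (_ + _); apply: eq_bigr => i _; rewrite !mxE.
split=> [[A1 [b1 [A2 [b2 fE]]]]|[c [z [b fE]]]].
  exists (fun i => A2 ord0 i), (fun i => row_mx (b1 i ord0)%:M (row i A1)), b2.
  move=> x /fE ->; rewrite netE; congr (_ + _); apply: eq_bigr => i _.
  rewrite affE row_mxEl mxE eqxx mulr1n; congr (_ * prelu a (_ + _)).
  by apply: eq_bigr => j _; rewrite row_mxEr mxE.
exists (\matrix_(i, j) z i ord0 (rshift 1 j)), (\col_i z i ord0 (lshift d ord0)),
  (\row_i c i), b => x /fE ->; rewrite netE; congr (_ + _); apply: eq_bigr => i _.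
rewrite !mxE affE; congr (_ * prelu a (_ + _)).
by apply: eq_bigr => j _; rewrite mxE.
Qed.

(** By positive homogeneity of [prelu a], the norm of [z] moves into the output weight. *)
Lemma normalize_neuron c z : exists c' z', \sum_j `|z' ord0 j| = 1 /\
  forall x, c * prelu a (aff z x) = c' * prelu a (aff z' x).
Proof.
pose s := \sum_j `|z ord0 j|.
have s_ge0 : 0 <= s by apply: sumr_ge0.
have [s0|s_neq0] := eqVneq s 0.
  (* A zero neuron contributes nothing, so output weight [0] with any function of norm 1 will do. *)
  exists 0, (const_aff 1); split.
    rewrite big_split_ord big_ord1 /= /const_aff row_mxEl mxE eqxx normr1.
    by rewrite big1 ?addr0// => j _; rewrite row_mxEr mxE normr0.
  have -> : z = 0.
    apply/rowP => j; rewrite mxE; apply/eqP; rewrite -normr_eq0.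
    by move/eqP: s0; rewrite psumr_eq0 // => /allP/(_ j);
      rewrite mem_index_enum => /(_ isT)/implyP->.
  by move=> x; rewrite pairing0l -[X in prelu a X](mul0r 0) preluZ// !mul0r mulr0.
exists (c * s), (s^-1 *: z); split.
  under eq_bigr do rewrite mxE normrM.
  by rewrite -mulr_sumr normfV (ger0_norm s_ge0) mulVf.
by move=> x; rewrite pairingZl preluZ ?invr_ge0// mulrA mulfK.
Qed.

(* On the cube, an affine function plus a large constant is positive, where
   [prelu] is linear: one neuron suffices to represent it. *)
Lemma RNN_spare_neuron (f : 'cV[R]_d -> R) (z : 'I_N0 -> 'rV[R]_(1 + d)) L
    (c : 'I_N0 -> R) i0 : c i0 = 0 ->
  (forall x, cube d B x -> f x = aff L x + \sum_i c i * prelu a (aff (z i) x)) ->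
  RNN d N0 a B f.
Proof.
move=> ci0 fE; apply/RNNP.
(* [C] bounds the absolute value of [aff L x] on the cube, and [s] is the slope of [prelu a] on the
   nonnegative reals. *)
pose C := \sum_j `|L ord0 (rshift 1 j)| * B + `|L ord0 (lshift d ord0)|.
pose s := (1 + a) / 2 + `|1 - a| / 2.
have s_gt0 : 0 < s by rewrite ltr_pwDl ?divr_gt0 ?divr_ge0 ?ltr_pwDl.
exists (fun i => if i == i0 then s^-1 else c i),
  (fun i => if i == i0 then L + const_aff C else z i), (- C) => x Bx.
rewrite fE// (bigD1 i0)//= [in RHS](bigD1 i0)//= ci0 mul0r add0r eqxx.
rewrite pairingDl aff_const [RHS]addrAC; congr (_ + _); last first.
  by apply: eq_bigr => i /negPf ->.
have LC : 0 <= aff L x + C.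
  rewrite -lerBlDr sub0r lerNl; apply: le_trans (ler_norm _) _.
  rewrite normrN affE; apply: le_trans (ler_normD _ _) _; rewrite lerD2r.
  apply: le_trans (ler_norm_sum _ _ _) _; apply: ler_sum => j _.
  by rewrite normrM ler_wpM2l// ler_norml.
by rewrite preluE (ger0_norm LC) -mulrDl mulKf ?gt_eqF// addrK.
Qed.

Lemma RNN_sequential_closure (f : 'cV[R]_d -> R) :
  closure (RNN d N0 a B) (f : {uniform` cube d B -> R}) ->
  exists g : nat -> 'cV[R]_d -> R, (forall n, RNN d N0 a B (g n)) /\
    forall x, cube d B x -> g n x @[n --> \oo] --> f x.
Proof.
move=> clf.
have /choice[g gP] n : exists g : 'cV[R]_d -> R, RNN d N0 a B g /\
    forall x, cube d B x -> `|f x - g x| < n.+1%:R^-1.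
  have n0 : 0 < n.+1%:R^-1 :> R by rewrite invr_gt0.
  have [|g [gR gf]] := clf [set h : {uniform` cube d B -> R} |
      forall x, cube d B x -> ball (f x) n.+1%:R^-1 (h x)].
    apply/uniform_nbhs; exists [set xy : R * R | ball xy.1 n.+1%:R^-1 xy.2].
      by split => //; exact: (entourage_ball _ (PosNum n0)).
  by exists g; split => // x /gf.
exists g; split => [n|x Bx]; first by have [] := gP n.
apply/cvgrPdist_lt => e e0.
apply: filterS (near_infty_natSinv_lt (PosNum e0)) => n /=.
by apply: lt_trans; have [_ ->] := gP n.
Qed.

End Networks.

(* RNN is closed in C([-B,B]^d) with the sup norm: every function continuous
   on the cube lying in the (uniform-on-the-cube) closure of RNN is in RNN. *)
Theorem theorem3p8 (R : realType) (d N0 : nat) (B a : R) :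
  0 < B -> 0 <= a ->
  forall f : 'cV[R]_d -> R,
    {within cube d B, continuous f} ->
    closure (RNN d N0 a B) (f : {uniform` cube d B -> R}) ->
    RNN d N0 a B f.
Proof.
move=> B_gt0 a_ge0 f f_cont /RNN_sequential_closure[g [gR gf]].
have /choice[h hP] n : exists h : ('I_N0 -> R) * ('I_N0 -> 'rV[R]_(1 + d)) * R,
    (forall i, \sum_j `|h.1.2 i ord0 j| = 1) /\
    forall x, cube d B x -> g n x = \sum_i h.1.1 i * prelu a (aff (h.1.2 i) x) + h.2.
  have /RNNP[c [z [b gE]]] := gR n.
  have /choice[cz czP] i : exists cz : R * 'rV[R]_(1 + d), \sum_j `|cz.2 ord0 j| = 1 /\
      forall x, c i * prelu a (aff (z i) x) = cz.1 * prelu a (aff cz.2 x).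
    by have [c' [z' H]] := normalize_neuron a (c i) (z i); exists (c', z').
  exists (fun i => (cz i).1, fun i => (cz i).2, b); split => [i|x Bx].
    by have [] := czP i.
  by rewrite gE//; congr (_ + _); apply: eq_bigr => i _; have [_] := czP i; apply.
pose c i n := (h n).1.1 i; pose z i n := (h n).1.2 i; pose b n := (h n).2.
(* Along an ultrafilter, all bounded sequences converge at once, without passing to subsequences. *)
have [U [UU oo_U]] := ultraFilterLemma eventually_filter.
have UF : ProperFilter U by exact: ultra_proper.
have {}gf x : cube d B x -> g n x @[n --> U] --> f x.
  by move=> Bx V /(gf x Bx) /oo_U.
have zE i n j : `|z i n ord0 j| <= 1.
  have [zn1 _] := hP n; rewrite -(zn1 i) (bigD1 j) //= lerDl; exact: sumr_ge0.
have /choice[zl z_cvg] i : exists zl, forall X,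
    pairing (z i n) X @[n --> U] --> pairing zl X.
  apply: weak_limit => X.
  have /choice[l zl] j : exists l : R, z i n ord0 j @[n --> U] --> l.
    exact: (ultra_bounded_cvg UU (zE i ^~ j)).
  exists (\sum_j l j * X j ord0); under eq_fun do rewrite pairingE.
  by apply: cvg_sumr => j _; exact: cvgMr_tmp.
(* The norm is 1 for every [n] and is continuous, so it cannot tend to 0. *)
have zl_neq0 i : zl i != 0.
  apply/eqP => zl0.
  have : \sum_j `|z i n ord0 j| @[n --> U] --> (0 : R).
    have zl_sum : \sum_j `|zl i ord0 j| = 0.
      by rewrite big1// => j _; rewrite zl0 mxE normr0.
    rewrite -[X in _ --> X]zl_sum; apply: cvg_sumr => j _; apply: cvg_norm.
    have := z_cvg i (delta_mx j ord0).
    by under eq_fun do rewrite pairing_delta; rewrite pairing_delta.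
  have -> : (fun n => \sum_j `|z i n ord0 j|) = cst 1.
    by apply/funext => n; have [zn1 _] := hP n; exact: zn1.
  have cst_cvg : cst 1 @ U --> (1 : R) by exact: cvg_cst.
  move=> cst_cvg0; have /eqP : (1 : R) = 0.
    exact: (@cvg_unique _ (@norm_hausdorff _ _) _ _ _ _ cst_cvg cst_cvg0).
  by rewrite oner_eq0.
(* If the output weights converge, so does the sum over the neurons, and the bias [b n] is a
   difference of convergent sequences. Its limit is read off at the origin. *)
have coef_case : (exists c' : 'I_N0 -> R, forall i, c i n @[n --> U] --> c' i) ->
    RNN d N0 a B f.
  move=> [c' cc']; apply/RNNP.
  have B0 : cube d B 0 by move=> i; rewrite mxE oppr_le0 ltW.
  pose S x := \sum_i c' i * prelu a (aff (zl i) x).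
  have S_cvg x : \sum_i c i n * prelu a (aff (z i n) x) @[n --> U] --> S x.
    by apply: cvg_sumr => i _; apply: cvgM => //; exact: prelu_cvg.
  have b_cvg x : cube d B x -> b n @[n --> U] --> f x - S x.
    move=> Bx.
    have -> : b = (fun n => g n x - \sum_i c i n * prelu a (aff (z i n) x)).
      by apply/funext => n; have [_ ->//] := hP n; rewrite addrAC subrr add0r.
    by apply: cvgB => //; exact: gf.
  exists c', zl, (f 0 - S 0) => x Bx; rewrite -/(S x).
  have := @cvg_unique _ (@norm_hausdorff _ _) _ _ _ _ (b_cvg x Bx) (b_cvg 0 B0).
  by move=> <-; rewrite addrC subrK.
pose beta := `|1 - a| / 2; pose alpha := (1 + a) / 2.
pose L n := alpha *: (\sum_i c i n *: z i n) + const_aff d (b n).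
have LE n x : cube d B x -> 
    g n x = aff (L n) x + \sum_i beta * c i n * `|aff (z i n) x|.
  move=> Bx; have [_ ->//] := hP n; rewrite /L pairingDl aff_const addrAC; congr (_ + _).
  rewrite pairingZl pairing_suml mulr_sumr -big_split; apply: eq_bigr => i _.
  rewrite preluE pairingZl -/alpha -/beta -/(c i n) -/(z i n) /=; ring.
(* [beta = 0] means [a = 1]: the networks are affine, and [limit_structure] with no absolute values
   shows that [f] is affine. *)
have [beta0|beta_neq0] := eqVneq beta 0.
  have [|||L' [c' [fE _]]] := @limit_structure R d 0 B U UF (fun _ _ => 0)
      (fun _ => 0) (fun _ _ => 0) L f B_gt0 _ _ f_cont.
  - by case.
  - by case.
  - move=> x Bx; apply: cvg_trans (gf x Bx); apply: near_eq_cvg; apply: filterE => n.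
    by rewrite (LE n x Bx) big_ord0 big1// => i _; rewrite beta0 !mul0r.
  (* Without neurons, convergence of the weights is vacuous; otherwise any neuron is spare. *)
  have [N00|N0_gt0] := posnP N0.
    apply: coef_case; exists (fun _ => 0) => i.
    by have := ltn_ord i; rewrite [X in (_ < X)%N]N00.
  apply: (RNN_spare_neuron a_ge0 (z := zl) (L := L') (c := fun=> 0)
    (i0 := Ordinal N0_gt0)) => //.
  move=> x Bx; rewrite fE// big_ord0 big1// => i _; exact: mul0r.
have [|L' [c' [fE [[i0 ci0]|[c'' cc]]]]] := @limit_structure R d N0 B U UF z zl
    (fun i n => beta * c i n) L f B_gt0 zl_neq0 z_cvg f_cont.
- move=> x Bx; apply: cvg_trans (gf x Bx); apply: near_eq_cvg; apply: filterE => n.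
  exact: LE.
(* Each absolute value is expressed through [prelu a] by [preluE], and the linear remainder joins
   the affine part. *)
- apply: (RNN_spare_neuron a_ge0 (z := zl)
    (L := L' - \sum_i (c' i * alpha / beta) *: zl i)
    (c := fun i => c' i / beta) (i0 := i0)) => //.
    by rewrite ci0 mul0r.
  move=> x Bx; rewrite fE// pairingBl pairing_suml -addrA; congr (_ + _).
  rewrite addrC -sumrB; apply: eq_bigr => i _.
  by rewrite preluE pairingZl -/alpha -/beta; field.
apply: coef_case; exists (fun i => beta^-1 * c'' i) => i.
have -> : c i = (fun n => beta^-1 * (beta * c i n)) by apply/funext => n; rewrite mulKf.
exact: cvgMl_tmp.
Qed.
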